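(* For every integer $k\ge 1$, the optimal winning probability of the $k$-party quantum cloning game $\mathrm{QCG}_k$ is $$\omega^*(\mathrm{QCG}_k)=\frac12+\frac1{2k}.$$
   Context: Notation: $[k]=\{0,\dots,k-1\}$; $\mathcal S(\mathcal H)$ is the set of density operators on a finite-dimensional Hilbert space $\mathcal H$; $|\Phi^+\rangle=\frac1{\sqrt2}(|00\rangle+|11\rangle)$. The game $\mathrm{QCG}_k$: a referee $R$ holds a qubit register, $\mathcal H_R=\mathbb C^2$, and there are $k$ collaborating, non-communicating players $P_0,\dots,P_{k-1}$. Before the game the players prepare an arbitrary joint quantum state between themselves and the referee. The referee draws $x\in[k]$ uniformly at random and sends $x$ to all players, who then act locally. The players win iff the projection onto $|\Phi^+\rangle_{RP_x}$, of the referee's register and the final qubit register of player $P_x$, succeeds. Formally, a strategy $S$ consists of: finite-dimensional auxiliary Hilbert spaces $\mathcal H_{E_0},\dots,\mathcal H_{E_{k-1}}$ of arbitrary dimension; qubit registers $\mathcal H_{P_i}=\mathbb C^2$; a state $\rho\in\mathcal S(\mathcal H_R\otimes\mathcal H_{P_0E_0}\otimes\cdots\otimes\mathcal H_{P_{k-1}E_{k-1}})$, where $\mathcal H_{P_iE_i}=\mathcal H_{P_i}\otimes\mathcal H_{E_i}$; and, for all $i,x\in[k]$, a completely positive trace-preserving map $\mathcal E^x_{P_iE_i\to P_i}$ from operators on $\mathcal H_{P_iE_i}$ to operators on $\mathcal H_{P_i}$. Its winning probability is $$\omega(\mathrm{QCG}_k,S)=\frac1k\sum_{x\in[k]}\mathrm{Tr}\Big[|\Phi^+\rangle\langle\Phi^+|_{RP_x}\;\mathrm{Tr}_{P_i:\,i\ne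 x}\Big[\big(\mathrm{id}_R\otimes\bigotimes_{i\in[k]}\mathcal E^x_{P_iE_i\to P_i}\big)(\rho)\Big]\Big],$$ and $\omega^*(\mathrm{QCG}_k)=\sup_S\omega(\mathrm{QCG}_k,S)$, the supremum being over all strategies (over all auxiliary spaces). *)

(* Defs.v *)
From HB Require Import structures.
From mathcomp Require Import all_boot all_order all_algebra.
From mathcomp Require Import spectral.
From mathcomp Require Import complex.
From mathcomp Require Import all_classical all_reals.

Set Implicit Arguments.
Unset Strict Implicit.
Unset Printing Implicit Defensive.

Import Order.TTheory GRing.Theory Num.Theory.

Local Open Scope ring_scope.
Local Open Scope sesquilinear_scope.

(* A finite-dimensional Hilbert space is given by a finite type T labelling an
   orthonormal basis: it is C^T, with C = R[i].  Operators on it are square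
   matrices of size #|T|; enum_rank : T -> 'I_#|T| gives the basis labels.
   The space labelled by X * Y is the tensor product of those labelled by X and
   by Y, and the space labelled by the dependent functions
   {dffun forall i, T i} is the tensor product over i of those labelled by the
   T i. *)
Notation ket_type R T := 'cV[R[i]]_#|(T : finType)|.
Notation op R T := 'M[R[i]]_#|(T : finType)|.

Section Operators.
Variable R : realType.

Definition entry (T : finType) (A : op R T) (s t : T) : R[i] :=
  A (enum_rank s) (enum_rank t).

Definition mkop (T : finType) (f : T -> T -> R[i]) : op R T :=
  \matrix_(i, j) f (enum_val i) (enum_val j).

(* The matrix unit |s><t|. *)
Definition ketbra (T : finType) (s t : T) : op R T :=
  delta_mx (enum_rank s) (enum_rank t).

(* The order on R[i] is such that 0 <= z means that z is real and
   nonnegative; in particular a positive operator is Hermitian. *)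
Definition positive_op (T : finType) (A : op R T) : Prop :=
  forall v : ket_type R T, 0 <= (v ^t* *m A *m v) 0 0.

Definition density_op (T : finType) (A : op R T) : Prop :=
  positive_op A /\ \tr A = 1.

Definition tens (X Y : finType) (A : op R X) (B : op R Y) : op R (X * Y)%type :=
  mkop (fun s t => entry A s.1 t.1 * entry B s.2 t.2).

Definition bigtens (I : finType) (T : I -> finType) (A : forall i, op R (T i)) :
    op R {dffun forall i, T i} :=
  mkop (fun s t : {dffun forall i, T i} => \prod_i entry (A i) (s i) (t i)).

(* Tensor products of linear maps between operator spaces, defined on matrix
   units by |s1 s2><t1 t2| |-> f |s1><t1| (x) g |s2><t2| (and similarly for
   families) and extended linearly. *)
Definition tensmap (X X' Y Y' : finType) (f : op R X -> op R X')
    (g : op R Y -> op R Y') (rho : op R (X * Y)%type) : op R (X' * Y')%type :=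
  \sum_(s : X * Y) \sum_(t : X * Y)
    entry rho s t *: tens (f (ketbra s.1 t.1)) (g (ketbra s.2 t.2)).

Definition bigtensmap (I : finType) (T T' : I -> finType)
    (f : forall i, op R (T i) -> op R (T' i))
    (rho : op R {dffun forall i, T i}) : op R {dffun forall i, T' i} :=
  \sum_(s : {dffun forall i, T i}) \sum_(t : {dffun forall i, T i})
    entry rho s t *: bigtens (fun i => f i (ketbra (s i) (t i))).

Definition completely_positive (X Y : finType) (f : op R X -> op R Y) : Prop :=
  forall (n : nat) (rho : op R ('I_n * X)%type),
    positive_op rho -> positive_op (tensmap (@idfun (op R 'I_n)) f rho).

Definition trace_preserving (X Y : finType) (f : op R X -> op R Y) : Prop :=
  forall rho : op R X, \tr (f rho) = \tr rho.

Definition cptp (X Y : finType) (f : {linear op R X -> op R Y}) : Prop :=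
  completely_positive f /\ trace_preserving f.

(* Partial trace over the factors T i with i != x of the second component. *)
Definition ptrace_others (Z I : finType) (T : I -> finType) (x : I)
    (rho : op R (Z * {dffun forall i, T i})%type) : op R (Z * T x)%type :=
  mkop (fun a b => \sum_(s : {dffun forall i, T i} | s x == a.2)
    \sum_(t : {dffun forall i, T i} |
            (t x == b.2) && [forall i, (i != x) ==> (s i == t i)])
      entry rho (a.1, s) (b.1, t)).

(* |Phi+> = (|00> + |11>) / sqrt 2. *)
Definition phi_plus : ket_type R ('I_2 * 'I_2)%type :=
  \col_i (if (enum_val i).1 == (enum_val i).2 then (Num.sqrt 2)^-1%:C%C else 0).

Definition phi_plus_proj : op R ('I_2 * 'I_2)%type := phi_plus *m phi_plus ^t*.

End Operators.

Section QuantumCloningGame.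
Variables (R : realType) (k : nat).

(* H_(P_i E_i) = C^2 (x) C^(d i), with d i the dimension of H_(E_i). *)
Definition playerT (d : 'I_k -> nat) (i : 'I_k) : finType :=
  ('I_2 * 'I_(d i))%type.

Definition qubitT (i : 'I_k) : finType := 'I_2.

(* No positivity constraint is needed on aux_dim: on a zero space there is no
   operator of trace 1. *)
Record strategy := Strategy {
  aux_dim : 'I_k -> nat;
  state : op R ('I_2 * {dffun forall i, playerT aux_dim i})%type;
  state_density : density_op state;
  channel : forall x i : 'I_k,
    {linear op R (playerT aux_dim i) -> op R (qubitT i)};
  channel_cptp : forall x i : 'I_k, cptp (channel x i)
}.

Definition final_state (S : strategy) (x : 'I_k) :
    op R ('I_2 * {dffun forall i, qubitT i})%type :=
  tensmap (@idfun (op R 'I_2)) (bigtensmap (fun i => channel S x i)) (state S).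

(* The trace is a nonnegative real element of R[i]; Re only changes its type. *)
Definition win_prob (S : strategy) : R :=
  k%:R^-1 * \sum_(x < k)
    complex.Re (\tr (phi_plus_proj R *m ptrace_others x (final_state S x))).

(* The real supremum `sup` is 0 by convention on a set that is empty or
   unbounded above. *)
Definition qcg_value : R := sup (range win_prob).

End QuantumCloningGame.

(* Main.v *)
Require Import Defs.
From HB Require Import structures.
From mathcomp Require Import all_boot all_order all_algebra.
From mathcomp Require Import spectral complex.
From mathcomp Require Import all_classical all_reals.
From mathcomp Require Import ring.

(* What a player other than P_x does on question x does not affect the reduced state on R P_x, so
   P_i may always act as if asked x = i.  The channels can then be absorbed into the shared state,
   and the winning probability becomes the expectation of (1/k) sum_x Phi_x in a state sigma of R
   and k qubits, where Phi_x is the projection onto |Phi+> of R P_x.  These projections satisfy the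
   Temperley-Lieb relation Phi_y Phi_x Phi_y = Phi_y / 4 for x != y, which bounds the norm of their
   sum by (k + 1) / 2.  The bound is attained on k |0>|0...0> + sum_x |1>|e_x>.  That sigma is
   positive follows from Kraus decompositions of the channels, obtained by diagonalizing their
   Choi matrices. *)

Import Order.TTheory GRing.Theory Num.Theory.
Local Open Scope ring_scope.
Local Open Scope sesquilinear_scope.

(** Used for polarization: with [c'] the conjugate of [c] and [a], [b] the adjoints of [u], [w],
    this expands the quadratic form of [A] at [u + c *: w]. *)
Lemma sesquilinear_expand (K : comPzRingType) n (a b : 'rV[K]_n) (A : 'M[K]_n)
    (u w : 'cV[K]_n) (c c' : K) :
  ((a + c' *: b) *m A *m (u + c *: w)) 0 0 =
  (a *m A *m u) 0 0 + c * (a *m A *m w) 0 0 +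
    c' * ((b *m A *m u) 0 0 + c * (b *m A *m w) 0 0).
Proof.
rewrite !mulmxDl !mulmxDr -!scalemxAl -!scalemxAr !mxE; ring.
Qed.

(** * Entrywise calculus of operators and of tensor products of maps *)

Section Operators.
Set Implicit Arguments.
Unset Strict Implicit.
Variable R : realType.
Local Notation C := R[i].
Implicit Types T X Y : finType.

Lemma sum_enum_rank T (F : 'I_#|T| -> C) : \sum_i F i = \sum_(s : T) F (enum_rank s).
Proof. by rewrite (reindex enum_rank) //; apply/onW_bij/enum_rank_bij. Qed.

Lemma sum_delta T (u : T) (F : T -> C) : \sum_v (v == u)%:R * F v = F u.
Proof.
rewrite (bigD1 u) //= eqxx mul1r big1 ?addr0 // => v /negPf ->.
by rewrite mul0r.
Qed.

Lemma sum_fiber (S T : finType) (h : S -> T) (G : T -> S -> C) :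
  \sum_y \sum_(s | h s == y) G y s = \sum_s G (h s) s.
Proof.
rewrite (exchange_big_dep predT) //=; apply: eq_bigr => s _.
by rewrite (big_pred1 (h s)) // => y; rewrite eq_sym.
Qed.

Lemma sum_pairs (X Y : finType) (F : X * Y -> X * Y -> C) :
  \sum_p \sum_q F p q = \sum_a \sum_b \sum_c \sum_d F (a, c) (b, d).
Proof.
transitivity (\sum_a \sum_c \sum_b \sum_d F (a, c) (b, d)).
  rewrite [RHS]pair_bigA; apply: eq_bigr => -[a c] _ /=.
  by rewrite [RHS]pair_bigA; apply: eq_bigr => -[].
by apply: eq_bigr => a _; rewrite exchange_big.
Qed.

Lemma entry_mkop T (f : T -> T -> C) s t : entry (mkop f) s t = f s t.
Proof. by rewrite /entry mxE !enum_rankK. Qed.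

Lemma op_ext T (A B : op R T) : (forall s t, entry A s t = entry B s t) -> A = B.
Proof.
by move=> eqAB; apply/matrixP => i j; rewrite -(enum_valK i) -(enum_valK j); apply: eqAB.
Qed.

Lemma op_ext_ket T (A B : op R T) : (forall v : ket_type R T, A *m v = B *m v) -> A = B.
Proof.
move=> eqAB; apply/matrixP => i j.
have /matrixP/(_ i 0) := eqAB (delta_mx j 0).
by rewrite -!colE !mxE.
Qed.

Lemma ket_ext T (u v : ket_type R T) :
  (forall r : T, u (enum_rank r) 0 = v (enum_rank r) 0) -> u = v.
Proof. by move=> uv; apply/colP => i; rewrite -(enum_valK i). Qed.

Lemma entry_sum T (I : Type) (r : seq I) (P : pred I) (F : I -> op R T) s t :
  entry (\sum_(i <- r | P i) F i) s t = \sum_(i <- r | P i) entry (F i) s t.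
Proof. by rewrite /entry summxE. Qed.

Lemma entryZ T (c : C) (A : op R T) s t : entry (c *: A) s t = c * entry A s t.
Proof. by rewrite /entry mxE. Qed.

Lemma entry_mulmx T (A B : op R T) s t :
  entry (A *m B) s t = \sum_u entry A s u * entry B u t.
Proof. by rewrite /entry mxE sum_enum_rank. Qed.

Lemma mxtrace_entry T (A : op R T) : \tr A = \sum_s entry A s s.
Proof. by rewrite /mxtrace sum_enum_rank. Qed.

Lemma mxtrace_mul T (A B : op R T) :
  \tr (A *m B) = \sum_p \sum_q entry A p q * entry B q p.
Proof. by rewrite mxtrace_entry; apply: eq_bigr => p _; rewrite entry_mulmx. Qed.

Lemma entry_ketbra T (s t u v : T) :
  entry (ketbra R s t) u v = (u == s)%:R * (v == t)%:R.
Proof. by rewrite /entry mxE !(inj_eq enum_rank_inj) -natrM mulnb. Qed.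

Lemma entry_tens X Y (A : op R X) (B : op R Y) s t :
  entry (tens A B) s t = entry A s.1 t.1 * entry B s.2 t.2.
Proof. exact: entry_mkop. Qed.

Lemma entry_bigtens (I : finType) (T : I -> finType) (A : forall i, op R (T i)) s t :
  entry (bigtens A) s t = \prod_i entry (A i) (s i) (t i).
Proof. exact: entry_mkop. Qed.

Lemma positive_opP T (A : op R T) :
  positive_op A <->
  (forall f : T -> C, 0 <= \sum_s \sum_t (f s)^* * entry A s t * f t).
Proof.
have form (v : ket_type R T) : (v ^t* *m A *m v) 0 0 =
    \sum_s \sum_t (v (enum_rank s) 0)^* * entry A s t * v (enum_rank t) 0.
  rewrite -mulmxA mxE sum_enum_rank; apply: eq_bigr => s _.
  rewrite !mxE sum_enum_rank mulr_sumr; apply: eq_bigr => t _.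
  by rewrite mulrA.
split=> [posA f|posA v]; last by rewrite form; apply: posA.
have := posA (\col_i f (enum_val i)); rewrite form.
by under eq_bigr do under eq_bigr do rewrite !mxE !enum_rankK.
Qed.

Lemma entry_tensmap X X' Y Y' (f : op R X -> op R X') (g : op R Y -> op R Y')
    (rho : op R (X * Y)%type) a b :
  entry (tensmap f g rho) a b = \sum_s \sum_t entry rho s t *
    (entry (f (ketbra R s.1 t.1)) a.1 b.1 * entry (g (ketbra R s.2 t.2)) a.2 b.2).
Proof.
rewrite /tensmap entry_sum; apply: eq_bigr => s _.
by rewrite entry_sum; apply: eq_bigr => t _; rewrite entryZ entry_tens.
Qed.

Lemma sum_pair_delta (X Y : finType) (x : X) (F : X * Y -> C) :
  \sum_p (x == p.1)%:R * F p = \sum_y F (x, y).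
Proof.
transitivity (\sum_a \sum_b (x == a)%:R * F (a, b)).
  by rewrite pair_bigA; apply: eq_bigr => -[].
rewrite (bigD1 x) //=.
rewrite [X in _ + X]big1 ?addr0; first by apply: eq_bigr => y _; rewrite eqxx mul1r.
by move=> a /negPf ax; apply: big1 => y _; rewrite eq_sym ax mul0r.
Qed.

Lemma entry_tensmap_id X Y Y' (g : op R Y -> op R Y') (rho : op R (X * Y)%type) a b :
  entry (tensmap (@idfun (op R X)) g rho) a b = \sum_s \sum_t
    entry rho (a.1, s) (b.1, t) * entry (g (ketbra R s t)) a.2 b.2.
Proof.
rewrite entry_tensmap.
transitivity (\sum_s (a.1 == s.1)%:R * \sum_t (b.1 == t.1)%:R *
   (entry rho s t * entry (g (ketbra R s.2 t.2)) a.2 b.2)).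
  apply: eq_bigr => s _; rewrite mulr_sumr; apply: eq_bigr => t _.
  rewrite entry_ketbra; ring.
rewrite sum_pair_delta; apply: eq_bigr => s _.
by rewrite sum_pair_delta.
Qed.

Lemma prod_sum_dffun (I : finType) (T : I -> finType) (F : forall i, T i -> C) :
  \prod_i \sum_(j : T i) F i j = \sum_(f : {dffun forall i, T i}) \prod_i F i (f i).
Proof.
rewrite (reindex (@dffun_of_fprod I T)); last exact/onW_bij/dffun_of_fprod_bij.
transitivity (\prod_i \sum_(j : T i) [ffun j => F i j] j).
  by apply: eq_bigr => i _; apply: eq_bigr => j _; rewrite ffunE.
(* Sums over the various [T i] become sums over one type of tagged elements, so that distributivity
   for ordinary functions applies. *)
under eq_bigr => i _ do rewrite (big_tag (fun i => fun_of_fin [ffun j => F i j])).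
rewrite bigA_distr_big_dep -big_fprod; apply: eq_bigr => f _.
by apply: eq_bigr => i _; rewrite !ffunE.
Qed.

(** * Positivity and Kraus decompositions *)

(* On matrix units, [f] agrees with [A |-> \sum_a K a *m A *m (K a) ^t*]. *)
Definition kraus_form X Y (f : op R X -> op R Y) (J : finType) (K : J -> Y -> X -> C) :=
  forall s t s' t',
    entry (f (ketbra R s t)) s' t' = \sum_a K a s' s * (K a t' t)^*.

Lemma adjmx_mul m n p (A : 'M[C]_(m, n)) (B : 'M[C]_(n, p)) :
  (A *m B) ^t* = B ^t* *m A ^t*.
Proof. by rewrite trmx_mul map_mxM. Qed.

Lemma adjmxD m n (A B : 'M[C]_(m, n)) : (A + B) ^t* = A ^t* + B ^t*.
Proof. by rewrite raddfD /= map_mxD. Qed.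

Lemma adjmxZ m n (c : C) (A : 'M[C]_(m, n)) : (c *: A) ^t* = c^* *: A ^t*.
Proof. by apply/matrixP => i j; rewrite !mxE rmorphM. Qed.

(** Polarization: the form is real at [d i + c *: d j]. Taking [c = 1] controls [A i j + A j i],
    taking [c = 'i] controls [A i j - A j i], and the two together give [A i j] as the conjugate of
    [A j i]. *)
Lemma positive_op_hermitian T (A : op R T) : positive_op A -> A = A ^t*.
Proof.
move=> A_pos.
pose d i : ket_type R T := delta_mx i 0.
have dA i j : ((d i) ^t* *m A *m d j) 0 0 = A i j.
  by rewrite trmx_delta map_delta_mx -rowE -colE !mxE.
have real i j (c : C) :
    A i i + c * A i j + c^* * (A j i + c * A j j) \is Num.real.
  rewrite -(dA i i) -(dA i j) -(dA j i) -(dA j j).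
  by have := A_pos (d i + c *: d j); rewrite adjmxD adjmxZ sesquilinear_expand => /ger0_real.
have diag i : A i i \is Num.real.
  by rewrite -(dA i i); apply/ger0_real/A_pos.
apply/matrixP => i j; rewrite !mxE.
have /CrealP := real i j 1; have /CrealP := real i j 'i.
have /CrealP := diag i; have /CrealP := diag j.
rewrite !(rmorphD, rmorphM, rmorph1, conjCi, rmorphN) /= => -> -> Hi H1.
have two_neq0 : (2 : C) != 0 by rewrite pnatr_eq0.
apply: (mulfI two_neq0).
have sum_eq : A i j + A j i = (A i j)^* + (A j i)^*.
  apply: (addrI (A i i + A j j)).
  transitivity (A i i + 1 * A i j + 1 * (A j i + 1 * A j j)); first by ring.
  by rewrite -H1; ring.
have dif_eq : A i j - A j i = (A j i)^* - (A i j)^*.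
  apply: (mulfI (neq0Ci C)); apply: (addrI (A i i - 'i ^+ 2 * A j j)).
  transitivity (A i i + 'i * A i j + - 'i * (A j i + 'i * A j j)); first by ring.
  by rewrite -Hi !conjCi; ring.
transitivity (A i j + A j i + (A i j - A j i)); first by ring.
by rewrite sum_eq dif_eq; ring.
Qed.

(** By the spectral theorem [A] is a sum of eigenvalues times projections onto eigenvectors; the
    square root of each eigenvalue is absorbed into its eigenvector. *)
Lemma positive_gram T (A : op R T) : positive_op A ->
  exists (J : finType) (K : J -> T -> C), forall s t, entry A s t = \sum_a K a s * (K a t)^*.
Proof.
move=> A_pos.
have /orthomx_spectralP A_spec : A \is normalmx.
  by apply/normalmxP; rewrite -positive_op_hermitian.
have P_unit := spectral_unitarymx A; rewrite (invmx_unitary P_unit) in A_spec.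
set P := spectralmx A in A_spec P_unit; set d := spectral_diag A in A_spec.
(* The form is tested on the [i]-th eigenvector. *)
have d_ge0 i : 0 <= d 0 i.
  have := A_pos (P ^t* *m delta_mx i 0).
  rewrite adjmx_mul trmxCK [in X in X -> _]A_spec !mulmxA.
  rewrite -!(mulmxA _ P (P^t*)) (unitarymxP P_unit) !mulmx1.
  by rewrite trmx_delta map_delta_mx -rowE -colE !mxE eqxx mulr1n.
exists 'I_#|T|, (fun a s => (P a (enum_rank s))^* * sqrtC (d 0 a)) => s t.
rewrite /entry A_spec mxE; apply: eq_bigr => a _.
rewrite mul_mx_diag !mxE rmorphM /= conjCK.
have /CrealP -> : sqrtC (d 0 a) \is Num.real by rewrite ger0_real ?sqrtC_ge0.
by rewrite -[in LHS](sqrtCK (d 0 a)); ring.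
Qed.

Lemma positive_op_sum T (I : finType) (A : I -> op R T) :
  (forall i, positive_op (A i)) -> positive_op (\sum_i A i).
Proof.
move=> A_pos v; rewrite mulmx_sumr mulmx_suml summxE.
by apply: sumr_ge0 => i _; apply: A_pos.
Qed.

Lemma positive_op_conj X Y (B : 'M[C]_(#|Y|, #|X|)) (A : op R X) :
  positive_op A -> @positive_op R Y (B *m A *m B ^t*).
Proof.
move=> A_pos v; have := A_pos (B ^t* *m v).
by rewrite adjmx_mul trmxCK !mulmxA.
Qed.

Lemma tensmap_id_positive (Z X Y J : finType) (f : op R X -> op R Y) (K : J -> Y -> X -> C)
    (rho : op R (Z * X)%type) :
  kraus_form f K -> positive_op rho -> positive_op (tensmap (@idfun (op R Z)) f rho).
Proof.
move=> fK rho_pos.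
(* [B a] is the identity on [Z] tensored with the Kraus operator [K a]. *)
pose B a : 'M[C]_(#|((Z * Y)%type : finType)|, #|((Z * X)%type : finType)|) := \matrix_(i, j)
  (((enum_val i).1 == (enum_val j).1)%:R * K a (enum_val i).2 (enum_val j).2).
suff -> : tensmap (@idfun (op R Z)) f rho = \sum_a B a *m rho *m (B a) ^t*.
  by apply: positive_op_sum => a; apply: positive_op_conj.
apply: op_ext => p q; rewrite entry_tensmap_id entry_sum.
transitivity (\sum_x \sum_x' \sum_a
    entry rho (p.1, x) (q.1, x') * (K a p.2 x * (K a q.2 x')^*)).
  by apply: eq_bigr => x _; apply: eq_bigr => x' _; rewrite fK mulr_sumr.
under eq_bigr do rewrite exchange_big /=; rewrite exchange_big /=.
apply: eq_bigr => a _; rewrite [RHS]/entry mxE sum_enum_rank.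
transitivity (\sum_v (q.1 == v.1)%:R * ((\sum_u (p.1 == u.1)%:R *
    (K a p.2 u.2 * entry rho u v)) * (K a q.2 v.2)^*)); last first.
  apply: eq_bigr => v _; rewrite !mxE !enum_rankK sum_enum_rank rmorphM /= conjC_nat.
  rewrite mulrCA; congr (_ * (_ * _)); apply: eq_bigr => u _.
  by rewrite !mxE !enum_rankK mulrA.
rewrite sum_pair_delta exchange_big /=; apply: eq_bigr => x' _.
by rewrite sum_pair_delta mulr_suml; apply: eq_bigr => x _ /=; ring.
Qed.

Lemma bigtensmap_ketbra (I : finType) (T T' : I -> finType)
    (f : forall i, op R (T i) -> op R (T' i)) s t :
  bigtensmap f (ketbra R s t) = bigtens (fun i => f i (ketbra R (s i) (t i))).
Proof.
rewrite /bigtensmap (bigD1 s) //= (bigD1 t) //= entry_ketbra !eqxx mulr1 scale1r.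
rewrite !big1 ?addr0 // => [u us|u ut].
  by apply: big1 => v _; rewrite entry_ketbra (negPf us) mul0r scale0r.
by rewrite entry_ketbra (negPf ut) mulr0 scale0r.
Qed.

Lemma bigtensmap_kraus (I : finType) (T T' J : I -> finType)
    (f : forall i, op R (T i) -> op R (T' i)) (K : forall i, J i -> T' i -> T i -> C) :
  (forall i, kraus_form (f i) (K i)) ->
  kraus_form (bigtensmap f)
    (fun (a : {dffun forall i, J i}) s' s => \prod_i K i (a i) (s' i) (s i)).
Proof.
move=> fK s t s' t'.
rewrite bigtensmap_ketbra entry_bigtens; under eq_bigr do rewrite fK.
rewrite prod_sum_dffun; apply: eq_bigr => a _.
by rewrite big_split rmorph_prod.
Qed.

(** Choi's argument: [rho] is the unnormalized maximally entangled state of [X] with a copy of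
    itself. The entries of its image under the identity tensored with [f] are the entries of [f] on
    matrix units, so a Gram decomposition of this positive operator is a Kraus decomposition of
    [f]. *)
Lemma cp_kraus X Y (f : op R X -> op R Y) : completely_positive f ->
  exists (J : finType) (K : J -> Y -> X -> C), kraus_form f K.
Proof.
pose rho : op R ('I_#|X| * X)%type :=
  mkop (fun p q => (p.1 == enum_rank p.2)%:R * (q.1 == enum_rank q.2)%:R).
move=> /(_ _ rho) f_cp.
have /f_cp/positive_gram[J [K fK]] : positive_op rho.
  apply/positive_opP => g.
  set z := \sum_p (p.1 == enum_rank p.2)%:R * g p.
  (* [rho] has rank one, so its quadratic form is a squared modulus. *)
  rewrite (_ : \sum_s _ = z^* * z); last first.
    rewrite /z rmorph_sum mulr_suml; apply: eq_bigr => p _ /=.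
    rewrite mulr_sumr; apply: eq_bigr => q _; rewrite entry_mkop rmorphM /= conjC_nat.
    ring.
  by rewrite mulrC mul_conjC_ge0.
exists J, (fun a y x => K a (enum_rank x, y)) => s t s' t'.
rewrite -fK entry_tensmap_id /= (bigD1 s) //= (bigD1 t) //= entry_mkop /= !eqxx !mul1r.
rewrite !big1 ?addr0 // => [u us|u ut].
  by apply: big1 => v _; rewrite entry_mkop /= (inj_eq enum_rank_inj) eq_sym (negPf us) !mul0r.
by rewrite entry_mkop /= !(inj_eq enum_rank_inj) [t == u]eq_sym (negPf ut) mulr0 mul0r.
Qed.

(** * Partial traces of product maps and no-signalling *)

Definition upd (I : finType) (T : I -> finType) (s : {dffun forall i, T i}) x (b : T x) :
  {dffun forall i, T i} := [ffun i => eqtype.dfwith (fun j => s j) b i].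

Lemma upd_in (I : finType) (T : I -> finType) (s : {dffun forall i, T i}) x (b : T x) :
  upd s b x = b.
Proof. by rewrite ffunE eqtype.dfwith_in. Qed.

Lemma upd_out (I : finType) (T : I -> finType) (s : {dffun forall i, T i}) x (b : T x) i :
  i != x -> upd s b i = s i.
Proof. by move=> ix; rewrite ffunE eqtype.dfwith_out // eq_sym. Qed.

Lemma updK (I : finType) (T : I -> finType) (s : {dffun forall i, T i}) x (b c : T x) :
  upd (upd s b) c = upd s c.
Proof.
by apply/ffunP => i; have [->|ix] := eqVneq i x; rewrite ?upd_in ?upd_out.
Qed.

(** The left side is the condition on the inner index in [ptrace_others]; hence that inner sum has
    exactly one term. *)
Lemma eq_upd (I : finType) (T : I -> finType) (s t : {dffun forall i, T i}) x (b : T x) :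
  (t x == b) && [forall i, (i != x) ==> (s i == t i)] = (t == upd s b).
Proof.
apply/andP/eqP => [[/eqP tx /forallP st]|->].
  apply/ffunP => i; have [->|ix] := eqVneq i x; first by rewrite upd_in.
  by rewrite upd_out //; have := st i; rewrite ix => /eqP.
split; first by rewrite upd_in.
by apply/forallP => i; apply/implyP => ix; rewrite upd_out.
Qed.

Lemma mxtrace_bigtens (I : finType) (T : I -> finType) (A : forall i, op R (T i)) :
  \tr (bigtens A) = \prod_i \tr (A i).
Proof.
transitivity (\sum_(s : {dffun forall i, T i}) \prod_i entry (A i) (s i) (s i)).
  by rewrite mxtrace_entry; apply: eq_bigr => s _; apply: entry_bigtens.
under [RHS]eq_bigr do rewrite mxtrace_entry.
by rewrite (prod_sum_dffun (fun i j => entry (A i) j j)).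
Qed.

(** The inner sum reduces to [t = upd s b]. The constraint [s x == a] is then made a factor of the
    product, which turns the outer sum into a product of sums, one per index. *)
Lemma ptrace_bigtens (I : finType) (T : I -> finType) (A : forall i, op R (T i)) x
    (a b : T x) :
  \sum_(s : {dffun forall i, T i} | s x == a)
    \sum_(t : {dffun forall i, T i} | (t x == b) && [forall i, (i != x) ==> (s i == t i)])
      entry (bigtens A) s t = entry (A x) a b * \prod_(i | i != x) \tr (A i).
Proof.
(* [j : T i] and [a : T x] are compared through their tagged versions. *)
pose B i (j : T i) : C :=
  if i == x then (Tagged T j == Tagged T a)%:R else entry (A i) j j.
have sumBx : \sum_j B x j = 1.
  rewrite (bigD1 a) //= /B !eqxx big1 ?addr0 // => j /negPf ja.
  by rewrite eq_Tagged /= ja.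
have -> : \prod_(i | i != x) \tr (A i) = \sum_(s : {dffun forall i, T i}) \prod_i B i (s i).
  rewrite -(prod_sum_dffun B) (bigD1 x (P := predT)) //= sumBx mul1r.
  by apply: eq_bigr => i /negPf ix; rewrite mxtrace_entry /B ix.
rewrite mulr_sumr big_mkcond; apply: eq_bigr => s _.
rewrite [in RHS](bigD1 x) //= {1}/B eqxx eq_Tagged /=.
case: eqP => [sa|_]; last by rewrite mul0r mulr0.
rewrite (big_pred1 (upd s b)) => [|t]; last exact: eq_upd.
rewrite entry_bigtens (bigD1 x) //= upd_in sa mul1r; congr (_ * _).
by apply: eq_bigr => i ix; rewrite upd_out // /B (negPf ix).
Qed.

Lemma mxtrace_ketbra T (s t : T) : \tr (ketbra R s t) = (s == t)%:R.
Proof.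
rewrite mxtrace_entry (bigD1 s) //= entry_ketbra eqxx mul1r big1 ?addr0 // => u /negPf us.
by rewrite entry_ketbra us mul0r.
Qed.

Lemma mxtrace_tensmap_id (Z X Y : finType) (f : op R X -> op R Y) (rho : op R (Z * X)%type) :
  (forall s t, \tr (f (ketbra R s t)) = (s == t)%:R) ->
  \tr (tensmap (@idfun (op R Z)) f rho) = \tr rho.
Proof.
move=> f_tr; rewrite !mxtrace_entry.
transitivity (\sum_z \sum_y entry (tensmap (@idfun (op R Z)) f rho) (z, y) (z, y)).
  by rewrite pair_bigA; apply: eq_bigr => -[].
transitivity (\sum_z \sum_x entry rho (z, x) (z, x)); last first.
  by rewrite pair_bigA; apply: eq_bigr => -[].
apply: eq_bigr => z _; under eq_bigr do rewrite entry_tensmap_id /=.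
rewrite exchange_big /=; apply: eq_bigr => s _.
rewrite exchange_big /=; under eq_bigr do rewrite -mulr_sumr -mxtrace_entry f_tr.
rewrite (bigD1 s) //= eqxx mulr1 big1 ?addr0 // => t.
by rewrite eq_sym => /negPf ->; rewrite mulr0.
Qed.

Lemma bigtensmap_tp (I : finType) (T T' : I -> finType)
    (f : forall i, op R (T i) -> op R (T' i)) s t :
  (forall i, trace_preserving (f i)) -> \tr (bigtensmap f (ketbra R s t)) = (s == t)%:R.
Proof.
move=> f_tp; rewrite bigtensmap_ketbra mxtrace_bigtens.
have [->|/eqP st] := eqVneq s t.
  by apply: big1 => i _; rewrite f_tp mxtrace_ketbra eqxx.
have [i sti] : exists i, s i != t i.
  apply/existsP; rewrite -negb_forall; apply/forallP => st'.
  by apply: st; apply/ffunP => i; apply/eqP.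
by rewrite (bigD1 i) //= f_tp mxtrace_ketbra (negPf sti) mul0r.
Qed.

Lemma entry_ptrace_others (Z I : finType) (T : I -> finType) (x : I)
    (rho : op R (Z * {dffun forall i, T i})%type) a b :
  entry (ptrace_others x rho) a b =
  \sum_(s : {dffun forall i, T i} | s x == a.2)
    \sum_(t : {dffun forall i, T i} |
            (t x == b.2) && [forall i, (i != x) ==> (s i == t i)])
      entry rho (a.1, s) (b.1, t).
Proof. exact: entry_mkop. Qed.

(** Each traced-out map acts on a matrix unit and preserves its trace, so all that remains of it is
    a Kronecker delta. *)
Lemma entry_ptrace_tensmap (Z I : finType) (T T' : I -> finType) (x : I)
    (f : forall i, op R (T i) -> op R (T' i)) (rho : op R (Z * {dffun forall i, T i})%type)
    a b :
  (forall i, trace_preserving (f i)) ->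
  entry (ptrace_others x (tensmap (@idfun (op R Z)) (bigtensmap f) rho)) a b =
  \sum_u \sum_v entry rho (a.1, u) (b.1, v) *
    (entry (f x (ketbra R (u x) (v x))) a.2 b.2 * \prod_(i | i != x) (u i == v i)%:R).
Proof.
move=> f_tp; rewrite entry_ptrace_others.
under eq_bigr do under eq_bigr do rewrite entry_tensmap_id /=.
under eq_bigr do rewrite exchange_big /=.
rewrite exchange_big /=; apply: eq_bigr => u _.
under eq_bigr do rewrite exchange_big /=.
rewrite exchange_big /=; apply: eq_bigr => v _.
under eq_bigr do rewrite -mulr_sumr.
rewrite -mulr_sumr bigtensmap_ketbra ptrace_bigtens; congr (_ * (_ * _)).
by apply: eq_bigr => i _; rewrite f_tp mxtrace_ketbra.
Qed.

(** No-signalling: [entry_ptrace_tensmap] mentions no map of the family but [f x]. *)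
Lemma ptrace_others_channels (Z I : finType) (T T' : I -> finType) (x : I)
    (f g : forall i, op R (T i) -> op R (T' i)) (rho : op R (Z * {dffun forall i, T i})%type) :
  (forall i, trace_preserving (f i)) -> (forall i, trace_preserving (g i)) ->
  f x =1 g x ->
  ptrace_others x (tensmap (@idfun (op R Z)) (bigtensmap f) rho) =
  ptrace_others x (tensmap (@idfun (op R Z)) (bigtensmap g) rho).
Proof.
move=> f_tp g_tp fg; apply: op_ext => a b.
apply: (etrans (entry_ptrace_tensmap rho a b f_tp)).
apply: (etrans _ (esym (entry_ptrace_tensmap rho a b g_tp))).
by apply: eq_bigr => u _; apply: eq_bigr => v _; rewrite fg.
Qed.

Lemma mxtrace_positive_ge0 T (A : op R T) : positive_op A -> 0 <= \tr A.
Proof.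
move=> A_pos; apply: sumr_ge0 => i _; have := A_pos (delta_mx i 0).
by rewrite trmx_delta map_delta_mx -rowE -colE !mxE.
Qed.

(** * Norm bound for sums of projections with Temperley-Lieb relations *)

(** A diagonal term would equal [- 2 * p x]; leaving these out of the full double sum raises the
    coefficient of the sum of [p] from [2 * n] to [2 * (n + 1)]. *)
Lemma sum_offdiag n (p : 'I_n -> C) (f : 'I_n -> 'I_n -> C) :
  (forall x, f x x = p x) ->
  \sum_x \sum_(y | y != x) (p x + p y - 2 * f x y - 2 * f y x) =
  2 * (n%:R + 1) * (\sum_x p x) - 4 * \sum_x \sum_y f x y.
Proof.
move=> fp; set g := fun x y => p x + p y - 2 * f x y - 2 * f y x.
transitivity (\sum_x (\sum_y g x y + 2 * p x)).
  apply: eq_bigr => x _; rewrite (bigD1 x (P := predT)) //=.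
  rewrite (_ : g x x = - 2 * p x) ?{1}/g; first by ring.
  by rewrite /g !fp; ring.
have -> : \sum_x (\sum_y g x y + 2 * p x) = \sum_x \sum_y g x y + 2 * \sum_x p x.
  by rewrite big_split /= mulr_sumr.
rewrite /g; under eq_bigr do rewrite !sumrB big_split /= sumr_const card_ord -!mulr_sumr.
rewrite !sumrB big_split /= sumr_const card_ord -!mulr_sumr sumrMnl -!(mulr_natl (\sum_x p x)).
rewrite [\sum_(x < n) \sum_(y < n) f y x]exchange_big /=; ring.
Qed.

(* For [x != y] the operator [E = P x - 2 P x P y] satisfies
   [E* E = P x + P y - 2 P x P y - 2 P y P x]; the expectation of the sum of these over all pairs
   bounds that of [Q ^ 2], for [Q = \sum_x P x], by [c = (n + 1) / 2] times that of [Q], and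
   [0 <= (Q - c) ^ 2] then bounds that of [Q] by [c]. *)
Lemma sum_projections_le T (n : nat) (P : 'I_n -> op R T) (rho : op R T) :
  (forall x, (P x) ^t* = P x) -> (forall x, P x *m P x = P x) ->
  (forall x y, x != y -> P y *m P x *m P y = 4^-1 *: P y) ->
  density_op rho -> \sum_x \tr (P x *m rho) <= (n%:R + 1) / 2.
Proof.
move=> P_herm P_idem P_tl [rho_pos rho_tr].
pose tau (A : op R T) := \tr (A *m rho).
have tauD A B : tau (A + B) = tau A + tau B by rewrite /tau mulmxDl mxtraceD.
have tauZ c A : tau (c *: A) = c * tau A by rewrite /tau -scalemxAl mxtraceZ.
have tau_sum (F : 'I_n -> op R T) : tau (\sum_i F i) = \sum_i tau (F i).
  by rewrite /tau mulmx_suml raddf_sum.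
have tau1 : tau 1%:M = 1 by rewrite /tau mul1mx.
have tau_sqr (A : op R T) : 0 <= tau (A ^t* *m A).
  rewrite /tau -mulmxA mxtrace_mulC; apply: (@mxtrace_positive_ge0 T).
  exact: (@positive_op_conj T T).
pose Q := \sum_x P x; set q := \sum_x _.
have tauQ : tau Q = q by rewrite tau_sum.
pose c : C := (n%:R + 1) / 2.
have Q_herm : Q ^t* = Q.
  by rewrite /Q raddf_sum /= map_mx_sum; apply: eq_bigr => x _; apply: P_herm.
have c_gt0 : 0 < c by rewrite divr_gt0 // ltr_wpDl // ler0n.
have c_real : c^* = c by apply/CrealP/gtr0_real.
have sqr1 : 0 <= tau (Q *m Q) - 2 * c * q + c ^+ 2.
  have := tau_sqr (Q - c%:M).
  have -> : (Q - c%:M) ^t* = Q - c%:M.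
    by rewrite raddfB /= map_mxB Q_herm tr_scalar_mx map_scalar_mx /= c_real.
  have -> : (Q - c%:M) *m (Q - c%:M) = Q *m Q + (- 2 * c) *: Q + c ^+ 2 *: 1%:M.
    rewrite mulmxBl !mulmxBr mul_mx_scalar mul_scalar_mx -scalar_mxM scale_scalar_mx.
    by rewrite mulr1 opprB mulNr mulr2n mulrDl mul1r scaleNr scalerDl opprD !addrA [in RHS]addrAC.
  by rewrite !tauD !tauZ tau1 tauQ mulr1 !mulNr.
have sqr2 : 0 <= 2 * (n%:R + 1) * q - 4 * tau (Q *m Q).
  have pair_ge0 x y : x != y ->
      0 <= tau (P x) + tau (P y) - 2 * tau (P x *m P y) - 2 * tau (P y *m P x).
    move=> xy; have := tau_sqr (P x - 2 *: (P x *m P y)).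
    have -> : (P x - 2 *: (P x *m P y)) ^t* = P x - 2 *: (P y *m P x).
      rewrite -[in RHS](P_herm x) -[in RHS](P_herm y) -adjmx_mul.
      by rewrite -!scaleNr adjmxD adjmxZ rmorphN rmorph_nat.
    have -> : (P x - 2 *: (P y *m P x)) *m (P x - 2 *: (P x *m P y)) =
        P x + P y + (-2) *: (P x *m P y) + (-2) *: (P y *m P x).
      rewrite mulmxBl !mulmxBr -!scalemxAl -!scalemxAr !mulmxA P_idem.
      rewrite -[P y *m P x *m P x]mulmxA P_idem P_tl //.
      (* The factor 2 in [E] is chosen so that the term [4 P y P x P y] becomes exactly [P y]. *)
      rewrite !scalerA (_ : 2 * 2 * 4^-1 = 1) ?scale1r; last by field.
      by rewrite !scaleNr opprB !addrA [P x - _ + _]addrAC.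
    by rewrite !tauD !tauZ !mulNr.
  have : 0 <= \sum_x \sum_(y | y != x)
      (tau (P x) + tau (P y) - 2 * tau (P x *m P y) - 2 * tau (P y *m P x)).
    by apply: sumr_ge0 => x _; apply: sumr_ge0 => y yx; apply: pair_ge0; rewrite eq_sym.
  rewrite (sum_offdiag (p := fun x => tau (P x)) (f := fun x y => tau (P x *m P y))).
    by rewrite mulmx_suml tau_sum; under [in X in _ -> X]eq_bigr do rewrite mulmx_sumr tau_sum.
  by move=> x; rewrite P_idem.
(* Adding a quarter of [sqr2] to [sqr1] cancels [tau (Q *m Q)]; since [2 * (n + 1) / 4 = c], what is
   left is [c ^+ 2 - c * q]. *)
have : 0 <= c * (c - q).
  have inv4 : 0 <= 4^-1 :> C by rewrite invr_ge0 ler0n.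
  have := addr_ge0 sqr1 (mulr_ge0 inv4 sqr2); congr (_ <= _).
  by rewrite /c; field.
by rewrite (pmulr_rge0 _ c_gt0) subr_ge0.
Qed.

End Operators.

(** * The Bell projections and the upper bound on the winning probability *)

Section Game.
Set Implicit Arguments.
Unset Strict Implicit.
Variables (R : realType) (k : nat).
Local Notation C := R[i].
Local Notation qubits := {dffun forall i : 'I_k, qubitT i}.
Implicit Types (x y : 'I_k) (s t : qubits).

(* |Phi+><Phi+| on the referee and player [x], tensored with the identity on the other players. *)
Definition bell x : op R ('I_2 * qubits)%type :=
  mkop (fun p q : 'I_2 * qubits => 2^-1 * ((p.1 == p.2 x) && (q.1 == q.2 x) &&
                           [forall i, (i != x) ==> (p.2 i == q.2 i)])%:R).

Lemma entry_bell x (p q : 'I_2 * qubits) : entry (bell x) p q =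
  2^-1 * ((p.1 == p.2 x) && (q.1 == q.2 x) && [forall i, (i != x) ==> (p.2 i == q.2 i)])%:R.
Proof. exact: entry_mkop. Qed.

(** Reduces products of the projections to sums over one bit, so that their relations can be checked
    on vectors. *)
Lemma bell_mul x (v : ket_type R ('I_2 * qubits)%type) a s :
  (bell x *m v) (enum_rank (a, s)) 0 =
  2^-1 * (a == s x)%:R * \sum_(c < 2) v (enum_rank (c, upd s (c : qubitT x))) 0.
Proof.
rewrite mxE sum_enum_rank mulr_sumr.
transitivity (\sum_(c < 2) \sum_t entry (bell x) (a, s) (c, t) * v (enum_rank (c, t)) 0).
  by rewrite pair_bigA; apply: eq_bigr => -[].
apply: eq_bigr => c _; rewrite (bigD1 (upd s (c : qubitT x))) //= big1 ?addr0.
  rewrite entry_bell /= -andbA [c == _]eq_sym.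
  by rewrite (eq_upd s (upd s (c : qubitT x)) (c : qubitT x)) eqxx andbT.
move=> t ts; rewrite entry_bell /= -andbA [c == _]eq_sym.
by rewrite (eq_upd s t (c : qubitT x)) (negPf ts) andbF mulr0 mul0r.
Qed.

Lemma bell_herm x : (bell x) ^t* = bell x.
Proof.
apply: op_ext => p q; rewrite /entry !mxE rmorphM fmorphV !rmorph_nat.
rewrite !enum_rankK [_ && (_ == _)]andbC; congr (_ * (_ && _)%:R).
by apply: eq_forallb => i; congr (_ ==> _); rewrite eq_sym.
Qed.

Lemma bell_idem x : bell x *m bell x = bell x.
Proof.
apply: op_ext_ket => v; apply: ket_ext => -[a s]; rewrite -mulmxA !bell_mul.
congr (_ * _).
transitivity (\sum_(c < 2) 2^-1 * \sum_(d < 2) v (enum_rank (d, upd s (d : qubitT x))) 0).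
  apply: eq_bigr => c _; rewrite bell_mul upd_in eqxx mulr1; congr (_ * _).
  by apply: eq_bigr => d _; rewrite updK.
by rewrite sumr_const card_ord -mulr_natl; field.
Qed.

(** The sums over a bit coming from the outer [bell y] and from [bell x] both collapse to the value
    [s x]. Player [x] thus gets the original bit back, and what remains is the sum [G] of a single
    [bell y], with the factors 1/2 of the two other projections. *)
Lemma bell_temperley_lieb x y : x != y -> bell y *m bell x *m bell y = 4^-1 *: bell y.
Proof.
move=> xy; apply: op_ext_ket => v; apply: ket_ext => -[a s].
rewrite -!mulmxA bell_mul -scalemxAl [RHS]mxE bell_mul.
set G := \sum_(c < 2) v _ 0.
rewrite [RHS]mulrCA; congr (_ * _).
transitivity (\sum_(c < 2) (c == s x)%:R * (4^-1 * G)); last by rewrite sum_delta.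
apply: eq_bigr => c _; rewrite bell_mul upd_out // -mulrA mulrCA.
have [->|_] := eqVneq c (s x); last by rewrite !mul0r.
rewrite !mul1r.
transitivity (2^-1 * \sum_(d < 2) (d == s x)%:R * (2^-1 * G)).
  congr (_ * _); apply: eq_bigr => d _; rewrite bell_mul upd_out 1?eq_sym // upd_in.
  rewrite -mulrA mulrCA; have [->|_] := eqVneq d (s x); last by rewrite !mul0r.
  congr (_ * (_ * _)); apply: eq_bigr => e _; congr (v (enum_rank (_, _)) 0).
  apply/ffunP => i; have [->|iy] := eqVneq i y; first by rewrite !upd_in.
  by rewrite !(upd_out _ _ iy); have [->|ix] := eqVneq i x; rewrite ?upd_in ?upd_out.
by rewrite sum_delta; field.
Qed.

Lemma entry_phi_plus_proj (p q : 'I_2 * 'I_2) :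
  entry (phi_plus_proj R) p q = 2^-1 * ((p.1 == p.2) && (q.1 == q.2))%:R.
Proof.
rewrite /entry /phi_plus_proj mxE big_ord1 !mxE !enum_rankK.
have sqr : (Num.sqrt (2 : R))^-1%:C%C * ((Num.sqrt (2 : R))^-1%:C%C)^* = 2^-1 :> C.
  rewrite [_^*]conjc_real -rmorphM -invfM -expr2 sqr_sqrtr ?ler0n //.
  by rewrite fmorphV rmorph_nat.
by case: eqP => _; case: eqP => _ /=; rewrite ?sqr ?mulr1 ?conjC0 ?mulr0 ?mul0r.
Qed.

(** The partial trace is adjoint to tensoring with the identity. A sum over the bit of player [x]
    and over the configurations with that bit is merged into one over all configurations by
    [sum_fiber]. *)
Lemma mxtrace_phi_plus_ptrace x (sigma : op R ('I_2 * qubits)%type) :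
  \tr (phi_plus_proj R *m ptrace_others x sigma) = \tr (bell x *m sigma).
Proof.
rewrite !mxtrace_mul !sum_pairs; apply: eq_bigr => a _; apply: eq_bigr => b _.
transitivity (\sum_(p < 2) \sum_(s : qubits) \sum_(t : qubits | t x == p)
    if [forall i, (i != x) ==> (s i == t i)] then
      entry (phi_plus_proj R) (a, p) (b, s x) * entry sigma (b, s) (a, t) else 0).
  apply: eq_bigr => p _; rewrite -(sum_fiber (fun s : qubits => s x) (fun q s =>
    \sum_(t : qubits | t x == p) if [forall i, (i != x) ==> (s i == t i)] then
      entry (phi_plus_proj R) (a, p) (b, q) * entry sigma (b, s) (a, t) else 0)).
  apply: eq_bigr => q _; rewrite entry_ptrace_others mulr_sumr; apply: eq_bigr => s _.
  by rewrite -big_mkcondr mulr_sumr.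
rewrite exchange_big /= [RHS]exchange_big /=; apply: eq_bigr => s _.
rewrite (sum_fiber (fun t : qubits => t x) (fun p t =>
    if [forall i, (i != x) ==> (s i == t i)] then
      entry (phi_plus_proj R) (a, p) (b, s x) * entry sigma (b, s) (a, t) else 0)).
apply: eq_bigr => t _; rewrite entry_phi_plus_proj entry_bell /=.
have -> : [forall i, (i != x) ==> (t i == s i)] = [forall i, (i != x) ==> (s i == t i)].
  by apply: eq_forallb => i; congr (_ ==> _); rewrite eq_sym.
by case: forallP => _; rewrite ?andbT // andbF mulr0 mul0r.
Qed.

Lemma win_probE (S : strategy R k) (sigma := tensmap (@idfun (op R 'I_2))
    (bigtensmap (fun i => channel S i i)) (state S)) :
  density_op sigma /\
  win_prob S = k%:R^-1 * \sum_(x < k) complex.Re (\tr (bell x *m sigma)).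
Proof.
have tp x i : trace_preserving (channel S x i) := (channel_cptp S x i).2.
have [rho_pos rho_tr] := state_density S.
split.
  split; last first.
    by rewrite mxtrace_tensmap_id // => s t; apply: bigtensmap_tp => i; apply: tp.
  (* The Kraus families of all players are needed at once, so the existentials are turned into
     functions of [i] by choice. *)
  have kraus i : {J : finType & {K : J -> qubitT i -> playerT (aux_dim S) i -> C |
      kraus_form (channel S i i) K}}.
    have /cid[J /cid[K fK]] := cp_kraus (channel_cptp S i i).1.
    by exists J, K.
  have := bigtensmap_kraus (fun i => projT2 (projT2 (kraus i))).
  by move/tensmap_id_positive; apply.
congr (_ * _); apply: eq_bigr => x _; rewrite -mxtrace_phi_plus_ptrace.
(* On question [x] the two families of channels agree at player [x], where both are
   [channel S x x]. *)
have -> // : ptrace_others x (final_state S x) = ptrace_others x sigma.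
by apply: ptrace_others_channels => // i; apply: tp.
Qed.

Lemma win_prob_le (k_gt0 : (0 < k)%N) (S : strategy R k) :
  win_prob S <= 1 / 2 + 1 / (2 * k%:R).
Proof.
have [sigma_density ->] := win_probE S; set sigma := tensmap _ _ _.
have := sum_projections_le bell_herm bell_idem bell_temperley_lieb sigma_density.
have -> : (k%:R + 1) / 2 = ((k%:R + 1) / 2)%:C%C :> C.
  by rewrite rmorphM rmorphD fmorphV rmorph1 !rmorph_nat.
rewrite lecE => /andP[_]; rewrite raddf_sum /= => le_sum.
have k_neq0 : k%:R != 0 :> R by rewrite pnatr_eq0 -lt0n.
have -> : 1 / 2 + 1 / (2 * k%:R) = k%:R^-1 * ((k%:R + 1) / 2) :> R by field.
by rewrite ler_wpM2l // invr_ge0 ler0n.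
Qed.

End Game.

(** * The channel that discards a one-dimensional auxiliary space *)

Section Drop.
Set Implicit Arguments.
Unset Strict Implicit.
Variable (R : realType).

(** The partial trace over a one-dimensional auxiliary space; it lets a player return the qubit
    unchanged. *)
Definition drop_aux (A : op R ('I_2 * 'I_1)%type) : op R 'I_2 :=
  mkop (fun s t => entry A (s, ord0) (t, ord0)).

Fact drop_aux_linear : linear drop_aux.
Proof.
move=> c A B; apply: op_ext => s t.
by rewrite /entry !mxE /entry !mxE.
Qed.

HB.instance Definition _ := GRing.isLinear.Build R[i] _ _ _ drop_aux drop_aux_linear.

Lemma entry_drop_aux_ketbra p q (s t : 'I_2) :
  entry (drop_aux (ketbra R p q)) s t = (p == (s, ord0))%:R * (q == (t, ord0))%:R.
Proof. by rewrite entry_mkop entry_ketbra [_ == p]eq_sym [_ == q]eq_sym. Qed.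

Lemma drop_aux_cptp : cptp drop_aux.
Proof.
split=> [n rho|rho].
  (* The only Kraus operator is the identification of ['I_2 * 'I_1] with ['I_2]. *)
  apply: (tensmap_id_positive (K := fun (_ : 'I_1) (s : 'I_2) (p : 'I_2 * 'I_1) =>
    (p == (s, ord0))%:R)) => p q s t.
  by rewrite big_ord1 entry_drop_aux_ketbra conjC_nat.
rewrite !mxtrace_entry; under eq_bigr do rewrite entry_mkop.
transitivity (\sum_(s < 2) \sum_(e < 1) entry rho (s, e) (s, e)).
  by apply: eq_bigr => s _; rewrite big_ord1.
by rewrite pair_bigA; apply: eq_bigr => -[].
Qed.

End Drop.

(** * A strategy attaining the bound *)

Section Optimal.
Set Implicit Arguments.
Unset Strict Implicit.
Variables (R : realType) (k : nat).
Hypothesis k_gt0 : (0 < k)%N.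
Local Notation C := R[i].
Local Notation qubits := {dffun forall i : 'I_k, qubitT i}.
Local Notation players := {dffun forall i : 'I_k, playerT (fun=> 1%N) i}.
Implicit Types (x y : 'I_k) (s t : qubits).

Definition all0 : qubits := [ffun i => ord0].
Definition e1 x : qubits := upd all0 (ord_max : qubitT x).

(* The amplitudes of k |0>|0...0> + \sum_x |1>|e_x>, an eigenvector of [\sum_x bell R x]. *)
Definition amp (p : 'I_2 * qubits) : C :=
  if p.1 == ord0 then k%:R * (p.2 == all0)%:R else \sum_x (p.2 == e1 x)%:R.

Lemma upd_all0 x : upd all0 (ord0 : qubitT x) = all0.
Proof.
apply/ffunP => i; have [->|ix] := eqVneq i x; first by rewrite upd_in ffunE.
by rewrite upd_out.
Qed.

Lemma upd_eq_e1 x y s : (upd s (ord_max : qubitT x) == e1 y) =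
  (x == y) && (upd s (ord0 : qubitT x) == all0).
Proof.
apply/eqP/andP => [sy|[/eqP <- /eqP s0]]; last by rewrite -(updK s (ord0 : qubitT x)) s0.
have xy : x = y.
  apply/eqP/negP => /negP xy; have /ffunP/(_ x) := sy.
  by rewrite upd_in upd_out // ffunE.
split; first exact/eqP.
by rewrite -(updK s (ord_max : qubitT x)) sy -xy /e1 updK upd_all0.
Qed.

Lemma e1_inj : injective e1.
Proof. by move=> x y /eqP; rewrite upd_eq_e1 => /andP[/eqP]. Qed.

Lemma amp_real p : (amp p)^* = amp p.
Proof.
rewrite /amp; case: ifP => _; first by rewrite rmorphM !rmorph_nat.
by rewrite rmorph_sum /=; apply: eq_bigr => x _; rewrite conjC_nat.
Qed.

(** This is the sum of [bell_mul] for the vector [amp]: bit 0 contributes [k] through |0>|0...0>,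
    bit 1 contributes 1 through |1>|e_x>, both under the same condition on the other players. *)
Lemma sum_amp_upd x s :
  \sum_(c < 2) amp (c, upd s (c : qubitT x)) =
  (k%:R + 1) * (upd s (ord0 : qubitT x) == all0)%:R.
Proof.
rewrite big_ord_recl big_ord1 mulrDl mul1r; congr (_ + _).
rewrite /amp /= (_ : lift ord0 ord0 = ord_max); last exact: val_inj.
rewrite (bigD1 x) //= upd_eq_e1 eqxx big1 ?addr0 // => y yx.
by rewrite upd_eq_e1 eq_sym (negPf yx).
Qed.

Lemma sum_amp_sqr : \sum_p amp p * amp p = k%:R * (k%:R + 1).
Proof.
transitivity (\sum_(a < 2) \sum_s amp (a, s) * amp (a, s)).
  by rewrite pair_bigA; apply: eq_bigr => -[].
rewrite big_ord_recl big_ord1 mulrDr mulr1; congr (_ + _).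
  transitivity (\sum_s (s == all0)%:R * (k%:R * k%:R) : C); last by rewrite sum_delta.
  apply: eq_bigr => s _; rewrite /amp /=; case: eqP => _ /=; ring.
rewrite /amp /=.
transitivity (\sum_s \sum_x (s == e1 x)%:R * \sum_y (s == e1 y)%:R : C).
  by apply: eq_bigr => s _; rewrite mulr_suml.
rewrite exchange_big /= -[RHS](_ : \sum_(x < k) 1 = _); last first.
  by rewrite sumr_const card_ord.
apply: eq_bigr => x _; rewrite (sum_delta (e1 x) (fun s => \sum_y (s == e1 y)%:R)).
rewrite (bigD1 x) //= eqxx big1 ?addr0 // => y.
by rewrite (inj_eq e1_inj) eq_sym => /negPf ->.
Qed.

(** The squared norm of the vector [amp], by [sum_amp_sqr]. *)
Definition norm2 : C := k%:R * (k%:R + 1).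

Lemma norm2_gt0 : 0 < norm2.
Proof. by rewrite mulr_gt0 ?ltr_wpDl ?ltr0n. Qed.

Definition qubits_of (u : players) : qubits := [ffun i => (u i).1].

(** The normalized projection onto [amp], with trivial auxiliary registers; the second factor
    carries no conjugate because the amplitudes are real. *)
Definition opt_state : op R ('I_2 * players)%type :=
  mkop (fun p q : 'I_2 * players =>
    norm2^-1 * (amp (p.1, qubits_of p.2) * amp (q.1, qubits_of q.2))).

Definition opt_final : op R ('I_2 * qubits)%type :=
  tensmap (@idfun (op R 'I_2)) (bigtensmap (fun i : 'I_k => @drop_aux R)) opt_state.

Lemma entry_opt_final p q : entry opt_final p q = norm2^-1 * (amp p * amp q).
Proof.
pose lift_aux s : players := [ffun i => (s i, ord0)].
have delta (u : players) (s : qubits) :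
    \prod_i (u i == (s i, ord0))%:R = (u == lift_aux s)%:R :> C.
  have [->|/eqP us] := eqVneq u (lift_aux s).
    by apply: big1 => i _; rewrite ffunE eqxx.
  have [i usi] : exists i, u i != (s i, ord0).
    apply/existsP; rewrite -negb_forall; apply/forallP => us'.
    by apply: us; apply/ffunP => i; rewrite ffunE; apply/eqP.
  by rewrite (bigD1 i) //= (negPf usi) mul0r.
have liftK s : qubits_of (lift_aux s) = s by apply/ffunP => i; rewrite !ffunE.
case: p q => [a s] [b t]; rewrite /opt_final entry_tensmap_id /=.
transitivity (\sum_u (u == lift_aux s)%:R * \sum_v (v == lift_aux t)%:R *
    entry opt_state (a, u) (b, v)).
  apply: eq_bigr => u _; rewrite mulr_sumr; apply: eq_bigr => v _.
  rewrite bigtensmap_ketbra entry_bigtens.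
  under eq_bigr do rewrite entry_drop_aux_ketbra.
  by rewrite big_split /= !delta; ring.
by rewrite !sum_delta entry_mkop /= !liftK.
Qed.

Lemma opt_state_density : density_op opt_state.
Proof.
split.
  apply/positive_opP => f.
  set z := \sum_p amp (p.1, qubits_of p.2) * f p.
  rewrite (_ : \sum_s _ = norm2^-1 * (z^* * z)).
    by rewrite mulr_ge0 ?invr_ge0 ?(ltW norm2_gt0) // mulrC mul_conjC_ge0.
  rewrite /z rmorph_sum mulr_suml mulr_sumr; apply: eq_bigr => p _ /=.
  rewrite !mulr_sumr; apply: eq_bigr => q _; rewrite entry_mkop rmorphM /= amp_real.
  ring.
(* The channels preserve the trace, so it is computed on [opt_final], where the auxiliary registers
   are gone. *)
rewrite -(mxtrace_tensmap_id (f := bigtensmap (fun i : 'I_k => @drop_aux R))); last first.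
  by move=> s t; apply: bigtensmap_tp => i; apply: (drop_aux_cptp R).2.
rewrite -/opt_final mxtrace_entry; under eq_bigr do rewrite entry_opt_final.
by rewrite -mulr_sumr sum_amp_sqr mulVf // gt_eqF // norm2_gt0.
Qed.

Definition opt_strategy : strategy R k :=
  Strategy opt_state_density (fun _ i => drop_aux_cptp R).

(** The trace is the expectation of [bell R x] in the normalized vector [amp]. [sum_amp_upd] is used
    twice, once for each side of the projection, whence the square of [k + 1]. *)
Lemma mxtrace_bell_opt x :
  \tr (bell R x *m opt_final) = norm2^-1 * (2^-1 * (k%:R + 1) ^+ 2).
Proof.
pose v : ket_type R ('I_2 * qubits)%type := \col_i amp (enum_val i).
have vE p : v (enum_rank p) 0 = amp p by rewrite mxE enum_rankK.
transitivity (norm2^-1 * \sum_p amp p * (bell R x *m v) (enum_rank p) 0).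
  rewrite mxtrace_mul mulr_sumr; apply: eq_bigr => p _.
  rewrite mxE sum_enum_rank !mulr_sumr; apply: eq_bigr => q _.
  by rewrite vE entry_opt_final /entry; ring.
congr (_ * _).
transitivity (\sum_a \sum_(s : qubits) (a == s x)%:R *
   (amp (a, s) * 2^-1 * ((k%:R + 1) * (upd s (ord0 : qubitT x) == all0)%:R))).
  rewrite pair_bigA; apply: eq_bigr => -[a s] _; rewrite bell_mul -sum_amp_upd.
  under eq_bigr do rewrite vE.
  by rewrite /=; ring.
rewrite exchange_big /=.
under eq_bigr do rewrite sum_delta.
transitivity (\sum_(c < 2) 2^-1 * (k%:R + 1) * amp (c, upd all0 (c : qubitT x))); last first.
  by rewrite -mulr_sumr sum_amp_upd upd_all0 eqxx mulr1; ring.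
transitivity (\sum_(c < 2) \sum_(s : qubits | s x == c)
   amp (s x, s) * 2^-1 * ((k%:R + 1) * (upd s (ord0 : qubitT x) == all0)%:R)).
  by rewrite (sum_fiber (fun s : qubits => s x) (fun _ s => amp (s x, s) * 2^-1 *
     ((k%:R + 1) * (upd s (ord0 : qubitT x) == all0)%:R))).
apply: eq_bigr => c _.
(* Once the bit of player [x] is [c], the remaining delta forces all other bits to be 0. *)
rewrite (bigD1 (upd all0 (c : qubitT x))) ?upd_in //= big1 ?addr0.
  by rewrite updK upd_all0 eqxx mulr1; ring.
move=> s /andP[/eqP sx /negP s_neq]; case: eqP => [s0|_]; last by rewrite !mulr0.
case: s_neq; rewrite -s0 updK -sx; apply/eqP/ffunP => i.
by have [->|ix] := eqVneq i x; rewrite ?upd_in ?upd_out.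
Qed.

Lemma win_prob_opt : win_prob opt_strategy = 1 / 2 + 1 / (2 * k%:R).
Proof.
have [_ ->] := win_probE opt_strategy.
have k_neq0 : k%:R != 0 :> R by rewrite pnatr_eq0 -lt0n.
have k1_neq0 : k%:R + 1 != 0 :> R by rewrite gt_eqF // ltr_wpDl.
have tr x : complex.Re (\tr (bell R x *m opt_final)) = (2 * k%:R)^-1 * (k%:R + 1) :> R.
  rewrite mxtrace_bell_opt.
  suff -> : norm2^-1 * (2^-1 * (k%:R + 1) ^+ 2) = ((2 * k%:R)^-1 * (k%:R + 1))%:C%C :> C by [].
  rewrite rmorphM fmorphV rmorphM rmorphD rmorph1 !rmorph_nat /norm2.
  have kC : k%:R != 0 :> C by rewrite pnatr_eq0 -lt0n.
  have k1C : k%:R + 1 != 0 :> C by rewrite gt_eqF // ltr_wpDl.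
  by field; rewrite kC k1C.
under eq_bigr do rewrite tr.
by rewrite sumr_const card_ord -mulr_natl; field.
Qed.

End Optimal.

Theorem theorem2 (R : realType) (k : nat) (k_ge1 : (1 <= k)%N) :
  qcg_value R k = 1 / 2 + 1 / (2 * k%:R).
Proof.
(* [sup] takes its default value 0 on an empty or unbounded set; this bound and [opt_strategy]
   exclude both cases. *)
have ub : ubound (range (@win_prob R k)) (1 / 2 + 1 / (2 * k%:R)).
  by move=> _ [S _ <-]; apply: win_prob_le.
apply/eqP; rewrite eq_le; apply/andP; split.
  by apply: ge_sup => //; exists (win_prob (opt_strategy R k_ge1)); exists (opt_strategy R k_ge1).
rewrite -(win_prob_opt R k_ge1); apply: ub_le_sup; last by exists (opt_strategy R k_ge1).
by exists (1 / 2 + 1 / (2 * k%:R)).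
Qed.
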